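(* Let $\mathcal{X}$ be a locally compact, Hausdorff, second-countable single-target state space, and let $X_k$ be the (finite) set of targets at time step $k$. Suppose the set $Z_k$ of measurements at time $k$ is generated as follows: given $X_k$, each target $x\in X_k$ independently generates a finite set $Z\subset\mathbb{R}^{n_z}$ of measurements with multi-object density $f(Z\mid x)$ (an arbitrary density on finite subsets of $\mathbb{R}^{n_z}$), clutter is an independent Poisson point process (PPP) with intensity $\lambda^C(\cdot)$, and $Z_k$ is the union of all target-generated sets and the clutter. Let $Z_k=\{z_k^1,\dots,z_k^{m_k}\}$ and let $Z_k^1,\dots,Z_k^{2^{m_k}-1}$ be the nonempty subsets of $Z_k$. Assume the predicted density $f_{k|k-1}$ of $X_k$ is a Poisson multi-Bernoulli mixture (PMBM): $$f_{k|k-1}(X)=\sum_{Y\uplus W=X} f^{\mathrm{p}}_{k|k-1}(Y)\,f^{\mathrm{mbm}}_{k|k-1}(W),\qquad f^{\mathrm{p}}_{k|k-1}(X)=e^{-\int\lambda_{k|k-1}(x)dx}\prod_{x\in X}\lambda_{k|k-1}(x),$$ $$f^{\mathrm{mbm}}_{k|k-1}(X)=\sum_{a\in\mathcal{A}_{k|k-1}}w^{a}_{k|k-1}\sum_{\uplus_{l=1}^{n_{k|k-1}}X^l=X}\ \prod_{i=1}^{n_{k|k-1}}f^{i,a^i}_{k|k-1}(X^i),$$ where each $f^{i,a^i}_{k|k-1}$ is a Bernoulli density with existence probability $r^{i,a^i}_{k|k-1}$ and single-target density $f^{i,a^i}_{k|k-1}(x)$, each Bernoulli $i\in\{1,\dots,n_{k|k-1}\}$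 has local hypotheses $a^i\in\{1,\dots,h^i_{k|k-1}\}$ with local weights $w^{i,a^i}_{k|k-1}$ and associated sets of measurement pairs $\mathcal{M}^{i,a^i}_{k-1}\subseteq\mathcal{M}_{k-1}$, the set $\mathcal{A}_{k|k-1}$ of global hypotheses consists of all tuples $a=(a^1,\dots,a^{n_{k|k-1}})$ with $\bigcup_i\mathcal{M}^{i,a^i}_{k-1}=\mathcal{M}_{k-1}$ and $\mathcal{M}^{i,a^i}_{k-1}\cap\mathcal{M}^{j,a^j}_{k-1}=\emptyset$ for $i\neq j$, and $w^a_{k|k-1}\propto\prod_i w^{i,a^i}_{k|k-1}$ normalised to sum to one over $\mathcal{A}_{k|k-1}$. Then the updated density $f_{k|k}(X)\propto f(Z_k\mid X)f_{k|k-1}(X)$ (the posterior of $X_k$ given $Z_k$) is again a PMBM of the same form (with $k-1$ replaced by $k$ in the measurement-pair sets, global hypotheses $\mathcal{A}_{k|k}$ defined by the same covering/disjointness condition with respect to $\mathcal{M}_k$, and global weights $w^a_{k|k}\propto\prod_i w^{i,a^i}_{k|k}$), with the following parameters. (i) The number of Bernoulli components is $n_{k|k}=n_{k|k-1}+2^{m_k}-1$, and the PPP intensity is $\lambda_{k|k}(x)=f(\emptyset\mid x)\lambda_{k|k-1}(x)$. (ii) For each $i\in\{1,\dots,n_{k|k-1}\}$, $h^i_{k|k}=2^{m_k}h^i_{k|k-1}$. Missed-detection hypotheses $a^i\in\{1,\dots,h^i_{k|k-1}\}$ have $\mathcal{M}^{i,a^i}_k=\mathcal{M}^{i,a^i}_{k-1}$,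 and with $l^{i,a^i,\emptyset}_{k|k}=\langle f^{i,a^i}_{k|k-1},f(\emptyset\mid\cdot)\rangle$: $$w^{i,a^i}_{k|k}=w^{i,a^i}_{k|k-1}\big[1-r^{i,a^i}_{k|k-1}+r^{i,a^i}_{k|k-1}l^{i,a^i,\emptyset}_{k|k}\big],\quad r^{i,a^i}_{k|k}=\frac{r^{i,a^i}_{k|k-1}l^{i,a^i,\emptyset}_{k|k}}{1-r^{i,a^i}_{k|k-1}+r^{i,a^i}_{k|k-1}l^{i,a^i,\emptyset}_{k|k}},\quad f^{i,a^i}_{k|k}(x)=\frac{f(\emptyset\mid x)f^{i,a^i}_{k|k-1}(x)}{l^{i,a^i,\emptyset}_{k|k}}.$$ For a predicted local hypothesis $\tilde a^i\in\{1,\dots,h^i_{k|k-1}\}$ and $j\in\{1,\dots,2^{m_k}-1\}$, the local hypothesis $a^i=\tilde a^i+h^i_{k|k-1}j$ has $r^{i,a^i}_{k|k}=1$, $\mathcal{M}^{i,a^i}_k=\mathcal{M}^{i,\tilde a^i}_{k-1}\cup\{(k,p):z_k^p\in Z_k^j\}$, and with $l^{i,a^i,Z_k^j}_{k|k}=\langle f^{i,\tilde a^i}_{k|k-1},f(Z_k^j\mid\cdot)\rangle$: $$w^{i,a^i}_{k|k}=w^{i,\tilde a^i}_{k|k-1}r^{i,\tilde a^i}_{k|k-1}l^{i,a^i,Z_k^j}_{k|k},\qquad f^{i,a^i}_{k|k}(x)=\frac{f(Z_k^j\mid x)f^{i,\tilde a^i}_{k|k-1}(x)}{l^{i,a^i,Z_k^j}_{k|k}}.$$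 (iii) For each $j\in\{1,\dots,2^{m_k}-1\}$, the new Bernoulli with index $i=n_{k|k-1}+j$ has $h^i_{k|k}=2$ local hypotheses: one with $\mathcal{M}^{i,1}_k=\emptyset$, $w^{i,1}_{k|k}=1$, $r^{i,1}_{k|k}=0$; and one with $\mathcal{M}^{i,2}_k=\{(k,p):z_k^p\in Z_k^j\}$ and, with $l^{Z_k^j}_{k|k}=\langle\lambda_{k|k-1},f(Z_k^j\mid\cdot)\rangle$, $$w^{i,2}_{k|k}=\delta_1\big[|Z_k^j|\big]\prod_{z\in Z_k^j}\lambda^C(z)+l^{Z_k^j}_{k|k},\qquad r^{i,2}_{k|k}=\frac{l^{Z_k^j}_{k|k}}{w^{i,2}_{k|k}},\qquad f^{i,2}_{k|k}(x)=\frac{f(Z_k^j\mid x)\lambda_{k|k-1}(x)}{l^{Z_k^j}_{k|k}}.$$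
   Context: For finite sets, $\uplus$ denotes disjoint union, and sums of the form $\sum_{Y\uplus W=X}$ (resp. $\sum_{\uplus_l X^l=X}$) range over all ordered decompositions of the fixed set $X$ into mutually disjoint, possibly empty, subsets. A Bernoulli density with existence probability $r$ and single-target density $p$ is $f(\emptyset)=1-r$, $f(\{x\})=rp(x)$, and $f(X)=0$ if $|X|>1$. Measurement $z_t^j$ (the $j$-th measurement at time $t$) is referred to by the pair $(t,j)$, and $\mathcal{M}_t$ denotes the set of all such pairs up to and including time $t$. $\langle a,b\rangle=\int a(x)b(x)\,dx$ for real functions on the target space. $\delta_1[u]=1$ if $u=1$ and $0$ otherwise. *)

(* Defs.v *)
From HB Require Import structures.
From mathcomp Require Import all_boot all_order all_algebra finmap.
From mathcomp Require Import all_classical all_reals all_analysis.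
Set Implicit Arguments. Unset Strict Implicit. Unset Printing Implicit Defensive.
Import Order.TTheory GRing.Theory Num.Theory numFieldNormedType.Exports.
Local Open Scope ring_scope.

Definition borel (T : ptopologicalType) := g_sigma_algebraType (@open T).

Section MultiObject.
Variables (R : realType) (T : ptopologicalType).
Variable mu : {measure set (borel T) -> \bar R}.

Definition inner (a b : T -> R) : R :=
  Rintegral mu [set: borel T] (fun x => a x * b x).

Definition subfs (X : {fset T}) (S : {set X}) : {fset T} :=
  [fset \val x | x in S]%fset.

Definition ppp_dens (lam : T -> R) (X : {fset T}) : R :=
  expR (- Rintegral mu [set: borel T] lam) * \prod_(x <- X) lam x.

Definition bern_dens (r : R) (p : T -> R) (X : {fset T}) : R :=
  match (X : seq T) with
  | [::] => 1 - r
  | [:: x] => r * p x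
  | _ => 0
  end.

(** Parameters of a PMBM (0-based indices: Bernoulli [i < pm_n],
    local hypothesis [a < pm_h i]). *)
Record pmbm := PMBM {
  pm_n : nat;
  pm_h : nat -> nat;
  pm_w : nat -> nat -> R;
  pm_r : nat -> nat -> R;
  pm_p : nat -> nat -> T -> R;
  pm_M : nat -> nat -> {fset nat * nat};
  pm_lam : T -> R
}.

Definition ghyp (P : pmbm) := {dffun forall i : 'I_(pm_n P), 'I_(pm_h P i)}.

Definition is_ghyp (P : pmbm) (Mall : {fset nat * nat}) (a : ghyp P) : bool :=
  ((\big[fsetU/fset0]_(i < pm_n P) pm_M P i (a i)) == Mall) &&
  [forall i : 'I_(pm_n P), forall j : 'I_(pm_n P),
     (i != j) ==> ((pm_M P i (a i) `&` pm_M P j (a j))%fset == fset0)].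

Definition gweight (P : pmbm) (Mall : {fset nat * nat}) (a : ghyp P) : R :=
  (\prod_(i < pm_n P) pm_w P i (a i)) /
  (\sum_(b : ghyp P | is_ghyp Mall b) \prod_(i < pm_n P) pm_w P i (b i)).

(** multi-Bernoulli mixture density; an ordered decomposition
    [X = X^1 u ... u X^n] (disjoint, possibly empty) is encoded by the
    map [D] sending each element of [X] to the index of its block *)
Definition mbm_dens (P : pmbm) (Mall : {fset nat * nat}) (X : {fset T}) : R :=
  \sum_(a : ghyp P | is_ghyp Mall a) gweight Mall a *
    \sum_(D : {ffun X -> 'I_(pm_n P)})
      \prod_(i < pm_n P)
        bern_dens (pm_r P i (a i)) (pm_p P i (a i))
                  (subfs [set x | D x == i]).

Definition pmbm_dens (P : pmbm) (Mall : {fset nat * nat}) (X : {fset T}) : R :=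
  \sum_(Y : {set X}) ppp_dens (pm_lam P) (subfs Y) * mbm_dens P Mall (subfs (~: Y)).

End MultiObject.

(** [Mset mt t] = M_t = all pairs (t', j), 1 <= t' <= t, 1 <= j <= mt t',
    where [mt t'] is the number of measurements at time t'. *)
Definition Mset (mt : nat -> nat) (t : nat) : {fset nat * nat} :=
  [fset tj | tj in [seq (t', j) | t' <- iota 1 t, j <- iota 1 (mt t')]]%fset.

Section Update.
Variables (R : realType) (T : ptopologicalType) (nz : nat).
Notation M := 'rV[R]_nz.
Variable mu : {measure set (borel T) -> \bar R}.
Variable nu : {measure set (borel M) -> \bar R}.
Variables (f : {fset M} -> T -> R)
          (lamC : M -> R).
Variables (k m : nat) (z : 'I_m -> M).  (* Z_k = {z_k^1..z_k^m}, z_k^p = z (p-1) *)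

Definition Zsub (S : {set 'I_m}) : {fset M} := [fset z p | p in S]%fset.
Definition Msub (S : {set 'I_m}) : {fset nat * nat} :=
  [fset (k, (val p).+1) | p in S]%fset.

Definition clutter_dens (S : {set 'I_m}) : R :=
  expR (- Rintegral nu [set: borel M] lamC) * \prod_(p in S) lamC (z p).

(** measurement likelihood f(Z_k | X): Z_k is the union of the clutter set
    and independent target-generated sets; sum over decompositions
    Z_k = Z^C u (u_{x in X} Z^x), encoded by [D : Z_k -> option X]
    ([None] = clutter). *)
Definition meas_lik (X : {fset T}) : R :=
  \sum_(D : {ffun 'I_m -> option X})
    clutter_dens [set p | D p == None] *
    \prod_(x : X) f (Zsub [set p | D p == Some x]) (val x).

Variable E : nat -> {set 'I_m}.   (* Z_k^j = Zsub (E j), 1 <= j <= 2^m - 1 *)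

(** the PMBM update (0-based indices). For an old Bernoulli [i < n],
    local hypothesis [a = b + h j] ([b < h], [0 <= j < 2^m]) with [j = 0]
    the missed detection and [j > 0] the association to Z_k^j.
    New Bernoulli [i = n + j - 1] (paper index n + j), hypotheses 0, 1
    (paper 1, 2). *)
Definition pmbm_update (P : pmbm R T) : pmbm R T :=
  let n := pm_n P in
  let h := pm_h P in
  let w := pm_w P in
  let r := pm_r P in
  let p := pm_p P in
  let lam := pm_lam P in
  let l0 i a := inner mu (p i a) (f fset0%fset) in
  let lZ i a j := inner mu (p i a) (f (Zsub (E j))) in
  let lN j := inner mu lam (f (Zsub (E j))) in
  let wN j := (if #|E j| == 1%N then 1 else 0) * (\prod_(q in E j) lamC (z q))
              + lN j in
  {| pm_n := (n + (2 ^ m - 1))%N;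
     pm_h := fun i => if (i < n)%N then (2 ^ m * h i)%N else 2%N;
     pm_w := fun i a =>
       if (i < n)%N then
         let b := (a %% h i)%N in let j := (a %/ h i)%N in
         if j == 0%N then w i b * (1 - r i b + r i b * l0 i b)
         else w i b * r i b * lZ i b j
       else let j := (i - n + 1)%N in
         if a == 0%N then 1 else wN j;
     pm_r := fun i a =>
       if (i < n)%N then
         let b := (a %% h i)%N in let j := (a %/ h i)%N in
         if j == 0%N then r i b * l0 i b / (1 - r i b + r i b * l0 i b)
         else 1
       else let j := (i - n + 1)%N in
         if a == 0%N then 0 else lN j / wN j;
     pm_p := fun i a x =>
       if (i < n)%N then
         let b := (a %% h i)%N in let j := (a %/ h i)%N in
         if j == 0%N then f fset0%fset x * p i b x / l0 i b
         else f (Zsub (E j)) x * p i b x / lZ i b j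
       else let j := (i - n + 1)%N in
         if a == 0%N then 0 else f (Zsub (E j)) x * lam x / lN j;
     pm_M := fun i a =>
       if (i < n)%N then
         let b := (a %% h i)%N in let j := (a %/ h i)%N in
         if j == 0%N then pm_M P i b
         else (pm_M P i b `|` Msub (E j))%fset
       else let j := (i - n + 1)%N in
         if a == 0%N then fset0%fset else Msub (E j);
     pm_lam := fun x => f fset0%fset x * lam x |}.

End Update.

(* Main.v *)
Require Import Defs.
From HB Require Import structures.
From mathcomp Require Import all_boot all_order all_algebra finmap.
From mathcomp Require Import all_classical all_reals all_analysis.
From mathcomp Require Import ring lra zify.
Set Implicit Arguments. Unset Strict Implicit. Unset Printing Implicit Defensive.
Import Order.TTheory GRing.Theory Num.Theory numFieldNormedType.Exports.
Local Open Scope ring_scope.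

(** Drop all normalising constants and fix a predicted global hypothesis.  The
    likelihood times the prior is then a sum over pairs [(D, G)], where [D]
    sends each measurement to the target (or clutter) that generated it and [G]
    sends each target to its prior Bernoulli (or to the PPP).  The updated
    density is a sum over triples [(J, c, G')]: the measurement set [J i] given
    to each old Bernoulli, the set [c] of activated new Bernoullis, and the
    allocation [G'] of targets to old Bernoullis, new Bernoullis and PPP; the
    covering and disjointness condition on the pairs of time [k] says that the
    sets used by [(J, c)] partition [Z_k].  A PPP target of [(D, G)] whose
    measurement set [S] is nonempty belongs to the new Bernoulli of [S], and a
    clutter measurement [p] activates the new Bernoulli of [{p}], which is then
    empty.  This is a weight-preserving bijection between the terms that do not
    vanish for trivial reasons.

    The updated parameters are normalised by inner products that may be zero.
    In that case the integrand vanishes almost everywhere, so the junk value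
    [x / 0 = 0] is harmless outside a null set of single-target states. *)

(** * The association bijection *)

Section Association.
Variables (R : comNzRingType) (X I K M : finType) (e : K -> {set M}).
Hypotheses (e_inj : injective e) (e_neq0 : forall u, e u != finset.set0).
Hypothesis e_onto : forall S : {set M}, S != finset.set0 -> exists u, e u = S.

Definition fiber (L : finType) (G : {ffun X -> option L}) (t : L) : {set X} :=
  [set x | G x == Some t].

Definition cell (J : {ffun I -> {set M}}) (c : {ffun K -> bool}) (t : I + K) :
    {set M} :=
  match t with
  | inl i => J i
  | inr u => if c u then e u else finset.set0
  end.

Definition exact_cover J c : bool :=
  [forall p, #|[pred t | p \in cell J c t]| == 1%N].

Lemma exact_coverP J c :
  reflect (forall p, exists t, forall t', (p \in cell J c t') = (t' == t))
          (exact_cover J c).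
Proof.
apply: (iffP forallP) => H p.
  have /eqP/mem_card1[t Ht] := H p.
  by exists t => t'; have := Ht t'; rewrite !inE.
have [t Ht] := H p; apply/eqP; rewrite -(card1 t).
by apply: eq_card => t'; rewrite !inE Ht.
Qed.

(** In an association, [None] stands for clutter on the measurement side and for the PPP on the
    target side. In a triple it stands for the updated PPP. *)
Let assoc := ({ffun M -> option X} * {ffun X -> option I})%type.
Let updhyp := ({ffun I -> {set M}} * {ffun K -> bool} *
               {ffun X -> option (I + K)})%type.

Definition detset (D : {ffun M -> option X}) (x : X) : {set M} :=
  [set p | D p == Some x].

(** As [e] enumerates the nonempty sets, [pick] fails exactly on an empty detection set, so an
    undetected PPP target stays in the PPP. *)
Definition label (u : assoc) : {ffun X -> option (I + K)} :=
  [ffun x => match u.2 x with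
             | Some i => Some (inl i)
             | None => omap inr [pick v | e v == detset u.1 x]
             end].

(** A new Bernoulli is active for one of two exclusive reasons: it holds a PPP target, or its set is
    a single clutter measurement. *)
Definition to_updhyp (u : assoc) : updhyp :=
  ([ffun i => \bigcup_(x in fiber u.2 i) detset u.1 x],
   [ffun v => [exists x, label u x == Some (inr v)] ||
              [exists p, (u.1 p == None) && (e v == [set p])]],
   label u).

Definition labcell (t : updhyp) (x : X) : {set M} :=
  if t.2 x is Some l then cell t.1.1 t.1.2 l else finset.set0.

(** In a valid triple each measurement lies in one cell and each cell holds at most one target, so
    [pick] has at most one candidate. It fails when the cell holds no target, and the measurement is
    then clutter. *)
Definition to_assoc (t : updhyp) : assoc :=
  ([ffun p => [pick x | p \in labcell t x]],
   [ffun x => if t.2 x is Some (inl i) then Some i else None]).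

(* The triples whose weight does not vanish identically. *)
Definition valid (t : updhyp) : bool :=
  [&& exact_cover t.1.1 t.1.2,
      [forall l, (#|fiber t.2 l| <= 1)%N],
      [forall i, (fiber t.2 (inl i) == finset.set0) ==> (t.1.1 i == finset.set0)] &
      [forall v, if fiber t.2 (inr v) == finset.set0
                 then t.1.2 v ==> (#|e v| == 1%N) else t.1.2 v]].

Lemma fiber_inj (L : finType) (G : {ffun X -> option L}) t :
  (#|fiber G t| <= 1)%N ->
  forall x y, G x = Some t -> G y = Some t -> x = y.
Proof. by move=> /card_le1_eqP H x y Gx Gy; apply: H; rewrite inE ?Gx ?Gy. Qed.

Lemma fiber_neq0P (L : finType) (G : {ffun X -> option L}) t :
  reflect (exists x, G x = Some t) (fiber G t != finset.set0).
Proof.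
apply: (iffP (set0Pn _)) => -[x]; first by rewrite inE => /eqP; exists x.
by exists x; rewrite inE; apply/eqP.
Qed.

Lemma to_assocK t : valid t -> to_updhyp (to_assoc t) = t.
Proof.
case: t => [[J c] G'] /and4P[/= /exact_coverP cov /forallP fib1 /forallP J0
  /forallP cP].
set t := (J, c, G').
have DE p x : p \in labcell t x -> [pick y | p \in labcell t y] = Some x.
  move=> px; case: pickP => [y py|/(_ x)]; last by rewrite px.
  congr Some; move: px py; rewrite /labcell /=.
  case Gx: (G' x) => [l|]; last by rewrite inE.
  case Gy: (G' y) => [l'|]; last by rewrite inE.
  have [l0 H] := cov p; rewrite !H => /eqP ll0 /eqP l'l0.
  by apply: (fiber_inj (fib1 l0)); rewrite ?Gx ?Gy ?ll0 ?l'l0.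
have SE x : detset (to_assoc t).1 x = labcell t x.
  apply/setP => p; rewrite inE ffunE; apply/eqP/idP; last exact: DE.
  by case: pickP => [y py [<-]|].
have c_lab x v : G' x = Some (inr v) -> c v.
  move=> Gx; have := cP v; case: ifPn => // /eqP/setP/(_ x).
  by rewrite !inE Gx eqxx.
have labE : label (to_assoc t) = G'.
  apply/ffunP => x; rewrite ffunE ffunE SE /labcell /=.
  case Gx: (G' x) => [[i|v]|] //=.
    rewrite (c_lab _ _ Gx); case: pickP => [v' /eqP/e_inj -> //|/(_ v)].
    by rewrite eqxx.
  by case: pickP => [v /eqP ev|//]; have := e_neq0 v; rewrite ev eqxx.
rewrite /to_updhyp labE; congr (_, _, _); apply/ffunP.
- move=> i; rewrite ffunE; apply/setP => p; apply/bigcupP/idP => [[x]|pi].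
    rewrite inE ffunE /= SE /labcell /=.
    by case: (G' x) => [[j|v]|] //= /eqP[->].
  have : fiber G' (inl i) != finset.set0.
    by apply: contraTneq (J0 i) => ->; rewrite eqxx /=; apply/set0Pn; exists p.
  case/fiber_neq0P => x Gx; exists x; first by rewrite inE ffunE /= Gx.
  by rewrite SE /labcell /= Gx.
- move=> v; rewrite ffunE; apply/orP/idP => [[/existsP[x /eqP]|]|cv].
  + exact: c_lab.
  + case/existsP => p /andP[]; rewrite ffunE; case: pickP => // noD _ /eqP ev.
    (* The cell of a clutter measurement holds no target. Validity then excludes an old Bernoulli
       and forces [e w] to be a singleton. *)
    have [[i|w] H] := cov p.
      have pi : p \in J i by have := H (inl i); rewrite /= eqxx.
      have : fiber G' (inl i) != finset.set0.
        by apply: contraTneq (J0 i) => ->; rewrite eqxx /=; apply/set0Pn; exists p.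
      by case/fiber_neq0P => x Gx; have := noD x; rewrite /labcell /= Gx /= pi.
    have := H (inr w); rewrite /= eqxx; case: ifPn => [cw pw|]; last by rewrite inE.
    have := cP w; case: ifPn => [_|/fiber_neq0P[x Gx] _]; last first.
      by have := noD x; rewrite /labcell /= Gx /= cw pw.
    rewrite cw /= => /cards1P[q eq]; move: pw; rewrite eq inE => /eqP pq.
    by rewrite -(_ : w = v) //; apply: e_inj; rewrite ev eq pq.
  + have := cP v; case: ifPn => [/eqP f0|/fiber_neq0P[x Gx] _].
      rewrite cv /= => /cards1P[p ep]; right; apply/existsP; exists p.
      (* [p] lies in no other cell and this one holds no target, so [p] is read back as clutter. *)
      rewrite ep eqxx andbT ffunE; case: pickP => // x; rewrite /labcell /=.
      case Gx: (G' x) => [l|]; last by rewrite inE.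
      have [l0 H] := cov p; rewrite H => /eqP ll0.
      have := H (inr v); rewrite /= cv ep inE eqxx => /esym/eqP vl0.
      by have /setP/(_ x) := f0; rewrite !inE Gx ll0 vl0 eqxx.
    by left; apply/existsP; exists x; rewrite Gx.
Qed.

(** Counterpart of [valid] for associations: a Bernoulli density vanishes on two or more targets, so
    all other associations have weight zero. *)
Definition simple (u : assoc) : bool := [forall i, (#|fiber u.2 i| <= 1)%N].

Lemma label_inr u x v : label u x = Some (inr v) -> u.2 x = None /\ e v = detset u.1 x.
Proof.
rewrite ffunE; case: (u.2 x) => //.
by case: pickP => //= w /eqP ew [<-].
Qed.

Lemma label_inl u x i : (label u x == Some (inl i)) = (u.2 x == Some i).
Proof. by rewrite ffunE; case: (u.2 x) => [j|] //; case: pickP. Qed.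

Lemma label_None u x : label u x = None -> detset u.1 x = finset.set0.
Proof.
rewrite ffunE; case: (u.2 x) => //; case: pickP => // no _.
by apply/eqP; apply: contraT => /e_onto[v ev]; have := no v; rewrite ev eqxx.
Qed.

Lemma simple_detset u x i : simple u -> u.2 x = Some i ->
  \bigcup_(y in fiber u.2 i) detset u.1 y = detset u.1 x.
Proof.
move=> /forallP fib1 ux; rewrite (_ : fiber _ _ = [set x]) ?big_set1 //.
apply/setP => y; rewrite !inE; apply/eqP/eqP => [uy|->//].
exact: (fiber_inj (fib1 i)).
Qed.

Lemma labcell_to_updhyp u x : simple u -> labcell (to_updhyp u) x = detset u.1 x.
Proof.
move=> su; rewrite /labcell /=; case ux: (label u x) => [[i|v]|] /=.
- move/eqP: ux; rewrite label_inl => /eqP ux.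
  by rewrite ffunE (simple_detset su ux).
- rewrite ffunE (_ : [exists _, _]) /=; last by apply/existsP; exists x; rewrite ux.
  by have [] := label_inr ux.
- by rewrite label_None.
Qed.

Lemma to_updhypK u : simple u -> to_assoc (to_updhyp u) = u.
Proof.
case: u => D G su; rewrite /to_assoc; congr (_, _); apply/ffunP.
  move=> p; rewrite ffunE; case: pickP => [x|noD].
    by rewrite labcell_to_updhyp // inE => /eqP.
  case Dp: (D p) => [x|//]; have := noD x.
  by rewrite labcell_to_updhyp //= inE Dp eqxx.
move=> x; rewrite ffunE /=; case lx: (label _ x) => [[i|v]|].
- by move/eqP: lx; rewrite label_inl => /eqP ->.
- by have [->] := label_inr lx.
- by move: lx; rewrite ffunE /=; case: (G x).
Qed.

(** A new Bernoulli activated by clutter contains only that clutter measurement, so a measurement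
    generated by a target lies in no cell but that of its target. *)
Lemma cell_to_updhyp_Some (u : assoc) p x l : simple u -> u.1 p = Some x ->
  p \in cell (to_updhyp u).1.1 (to_updhyp u).1.2 l -> label u x = Some l.
Proof.
case: u => D G su /= Dp; case: l => [i|v] /=; rewrite ffunE.
  case/bigcupP => y; rewrite !inE /= Dp => /eqP Gy /eqP[xy].
  by apply/eqP; rewrite label_inl xy Gy.
case: ifPn => [/orP[|]|]; last by rewrite inE.
  by case/existsP => y /eqP ly; have [_ ->] := label_inr ly; rewrite inE /= Dp => /eqP[->].
case/existsP => q /andP[/eqP Dq /eqP ->]; rewrite inE => /eqP pq.
by move: Dp; rewrite pq Dq.
Qed.

Lemma cell_to_updhyp_None (u : assoc) p l : u.1 p = None ->
  p \in cell (to_updhyp u).1.1 (to_updhyp u).1.2 l ->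
  exists2 v, l = inr v & e v = [set p].
Proof.
case: u => D G /= Dp; case: l => [i|v] /=; rewrite ffunE.
  by case/bigcupP => y; rewrite !inE /= Dp.
case: ifPn => [/orP[|]|]; last by rewrite inE.
  by case/existsP => y /eqP ly; have [_ ->] := label_inr ly; rewrite inE /= Dp.
case/existsP => q /andP[/eqP Dq /eqP ev]; rewrite ev inE => /eqP pq.
by exists v; rewrite // ev pq.
Qed.

Lemma valid_to_updhyp u : simple u -> valid (to_updhyp u).
Proof.
move=> su; apply/and4P; split.
- apply/exact_coverP => p; case Dp: (u.1 p) => [x|].
    have px : p \in labcell (to_updhyp u) x.
      by rewrite labcell_to_updhyp // inE Dp.
    move: px; rewrite /labcell /=; case lx: (label u x) => [l|]; last by rewrite inE.
    move=> pl; exists l => l'; apply/idP/eqP => [|-> //].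
    by move/(cell_to_updhyp_Some su Dp); rewrite lx => -[].
  have [v ev] : exists v, e v = [set p].
    by apply: e_onto; apply/set0Pn; exists p; rewrite inE.
  exists (inr v) => l; apply/idP/eqP => [|->].
    by case/(cell_to_updhyp_None Dp) => w -> ew; congr inr; apply: e_inj; rewrite ev.
  rewrite /= ffunE; have -> : [exists q, (u.1 q == None) && (e v == [set q])].
    by apply/existsP; exists p; rewrite Dp ev !eqxx.
  by rewrite orbT ev inE.
- apply/forallP => -[i|v] /=.
    rewrite (_ : fiber _ _ = fiber u.2 i); first by have /forallP := su.
    by apply/setP => x; rewrite !inE label_inl.
  apply/card_le1_eqP => x y; rewrite !inE => /eqP lx /eqP ly.
  have [_ ex] := label_inr lx; have [_ ey] := label_inr ly.
  (* A measurement in the nonempty set [e v] has only one generator, so the two targets coincide. *)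
  have /set0Pn[p] := e_neq0 v => pv.
  have := pv; rewrite ex inE => /eqP Dx; have := pv; rewrite ey inE Dx.
  by move=> /eqP[].
- apply/forallP => i; apply/implyP => /eqP f0; rewrite ffunE big_pred0 //= => x.
  by have /setP/(_ x) := f0; rewrite !inE label_inl.
- apply/forallP => v; case: ifPn => [/eqP f0|/fiber_neq0P[x lx]]; rewrite ffunE.
    apply/implyP => /orP[/existsP[x lx]|].
      by have /setP/(_ x) := f0; rewrite !inE lx.
    by case/existsP => p /andP[_ /eqP ->]; rewrite cards1.
  by apply/orP; left; apply/existsP; exists x; rewrite lx.
Qed.

Lemma simple_to_assoc t : valid t -> simple (to_assoc t).
Proof.
case/and4P => _ /forallP fib1 _ _; apply/forallP => i.
rewrite (_ : fiber _ _ = fiber t.2 (inl i)) //.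
by apply/setP => x; rewrite !inE ffunE; case: (t.2 x) => [[j|v]|].
Qed.


(** * Weights of associations and of updated terms *)

Variables (g : X -> R) (phi : {set M} -> X -> R) (clut : M -> R).
Variable (B : I -> {set X} -> R).
Hypothesis B_card : forall i (V : {set X}), (1 < #|V|)%N -> B i V = 0.

Definition old_factor (S : {set M}) (V : {set X}) : R :=
  if V == finset.set0 then (S == finset.set0)%:R else \prod_(x in V) phi S x.

(** Local weight times Bernoulli density of a new Bernoulli. Active and empty means one clutter
    measurement, active and occupied means one detected PPP target; an inactive one has existence
    probability 0. *)
Definition new_factor (v : K) (b : bool) (V : {set X}) : R :=
  if b then
    if V == finset.set0 then (#|e v| == 1%N)%:R * \prod_(p in e v) clut p
    else (#|V| == 1%N)%:R * \prod_(x in V) (phi (e v) x * g x)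
  else (V == finset.set0)%:R.

Definition assoc_weight (u : assoc) : R :=
  (\prod_(p | u.1 p == None) clut p) * (\prod_x phi (detset u.1 x) x) *
  ((\prod_(x | u.2 x == None) g x) * \prod_i B i (fiber u.2 i)).

Definition upd_weight (t : updhyp) : R :=
  (\prod_(x | t.2 x == None) (phi finset.set0 x * g x)) *
  (\prod_i (B i (fiber t.2 (inl i)) * old_factor (t.1.1 i) (fiber t.2 (inl i)))) *
  \prod_v new_factor v (t.1.2 v) (fiber t.2 (inr v)).

Lemma prod_eq0 (L : finType) (F : L -> R) l : F l = 0 -> \prod_l F l = 0.
Proof. by move=> Fl; rewrite (bigD1 l) //= Fl mul0r. Qed.

Lemma assoc_weight_eq0 u : ~~ simple u -> assoc_weight u = 0.
Proof.
case/forallPn => i; rewrite -ltnNge => ui.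
by rewrite /assoc_weight (@prod_eq0 _ _ i) ?mulr0 // B_card.
Qed.

(** Once the cover holds, a failing clause of [valid] makes one factor zero: two targets in a
    Bernoulli, measurements in an empty old one, an empty new one active on a non-singleton, or an
    occupied inactive one. *)
Lemma upd_weight_eq0 t : exact_cover t.1.1 t.1.2 -> ~~ valid t -> upd_weight t = 0.
Proof.
move=> cov; rewrite /valid cov /= !negb_and => /or3P[] /forallPn[l].
- rewrite -ltnNge => tl; have tl0 : fiber t.2 l != finset.set0.
    by rewrite -card_gt0 (ltn_trans _ tl).
  case: l tl tl0 => [i|v] tl tl0; rewrite /upd_weight.
    by rewrite (@prod_eq0 _ _ i) ?mulr0 ?mul0r // B_card // mul0r.
  rewrite (@prod_eq0 _ _ v) ?mulr0 // /new_factor (negPf tl0).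
  by case: (t.1.2 v) => //; rewrite gtn_eqF // mul0r.
- rewrite negb_imply => /andP[tl0 Jl]; rewrite /upd_weight.
  rewrite (@prod_eq0 _ _ l) ?mulr0 ?mul0r //.
  by rewrite /old_factor tl0 (negPf Jl) mulr0.
- move=> H; rewrite /upd_weight (@prod_eq0 _ _ l) ?mulr0 // /new_factor.
  move: H; case: ifP => // _; last by case: (t.1.2 l).
  by case: (t.1.2 l) => //= /negPf ->; rewrite mul0r.
Qed.

Lemma prod_fibers (L : finType) (G : {ffun X -> option L}) (F : L -> X -> R) :
  \prod_l \prod_(x in fiber G l) F l x =
  \prod_x (if G x is Some l then F l x else 1).
Proof.
rewrite (exchange_big_dep xpredT) //=; apply: eq_bigr => x _.
case Gx: (G x) => [l|]; last by rewrite big1 // => l; rewrite inE Gx.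
rewrite (big_pred1 l) // => l'; rewrite inE Gx.
by apply/eqP/eqP => [[->]|->].
Qed.

Lemma old_factor_to_updhyp u i : simple u ->
  old_factor ((to_updhyp u).1.1 i) (fiber (label u) (inl i)) =
  \prod_(x in fiber u.2 i) phi (detset u.1 x) x.
Proof.
move=> su; have -> : fiber (label u) (inl i) = fiber u.2 i.
  by apply/setP => x; rewrite !inE label_inl.
rewrite /old_factor ffunE; case: eqP => [->|_]; first by rewrite !big_set0 eqxx.
by apply: eq_bigr => x; rewrite inE => /eqP ux; rewrite (simple_detset su ux).
Qed.

(** The clutter product has at most one factor. It is empty when a target occupies the Bernoulli,
    since the measurements of [e v] are then not clutter. *)
Lemma new_factor_to_updhyp u v : simple u ->
  new_factor v ((to_updhyp u).1.2 v) (fiber (label u) (inr v)) =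
  (\prod_(x in fiber (label u) (inr v)) (phi (detset u.1 x) x * g x)) *
  \prod_(p | (u.1 p == None) && (e v == [set p])) clut p.
Proof.
move=> su; have /and4P[_ /forallP fib1 _ /forallP cP] := valid_to_updhyp su.
rewrite /new_factor; have := cP v; case: ifPn => [/eqP f0|f1] /=; last first.
  move=> ->; rewrite [X in _ = _ * X]big_pred0 ?mulr1.
    rewrite (_ : #|_| == 1%N) ?mul1r.
      by apply: eq_bigr => x; rewrite inE => /eqP lx; have [_ ->] := label_inr lx.
    by rewrite eqn_leq fib1 card_gt0.
  move=> p; apply/negbTE/negP => /andP[/eqP Dp /eqP ev].
  case/fiber_neq0P: f1 => x lx; have [_ ev'] := label_inr lx.
  have : p \in detset u.1 x by rewrite -ev' ev inE.
  by rewrite inE Dp.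
rewrite f0 big_set0 mul1r => _; rewrite ffunE (_ : [exists x, _] = false) /=.
  case: ifPn => [/existsP[p /andP[/eqP Dp /eqP ev]]|/existsPn no].
    rewrite ev cards1 eqxx mul1r big_set1 (big_pred1 p) // => q.
    rewrite (inj_eq set1_inj) eq_sym; apply/andP/eqP => [[_ /eqP->//]|->].
    by rewrite Dp !eqxx.
  by rewrite big_pred0 // => p; apply/negbTE/no.
by apply/existsP => -[x lx]; have /setP/(_ x) := f0; rewrite !inE lx.
Qed.

Lemma upd_weight_to_updhyp u : simple u -> upd_weight (to_updhyp u) = assoc_weight u.
Proof.
move=> su; rewrite /upd_weight /assoc_weight -[(to_updhyp u).2]/(label u).
have fiber_inl i : fiber (label u) (inl i) = fiber u.2 i.
  by apply/setP => x; rewrite !inE label_inl.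
rewrite [X in _ * X * _]big_split /=.
rewrite (eq_bigr (fun i => B i (fiber u.2 i))) => [|i _]; last by rewrite fiber_inl.
under [X in _ * (_ * X) * _]eq_bigr => i _ do rewrite old_factor_to_updhyp //.
under [X in _ * X = _]eq_bigr => v _ do rewrite new_factor_to_updhyp //.
rewrite [X in _ * X = _]big_split.
(* Each clutter measurement belongs to exactly one new Bernoulli, that of its singleton. *)
have -> : \prod_v \prod_(p | (u.1 p == None) && (e v == [set p])) clut p =
          \prod_(p | u.1 p == None) clut p.
  rewrite (exchange_big_dep (fun p => u.1 p == None)) /=; last by move=> ? ? _ /andP[].
  apply: eq_bigr => p up.
  have [v ev] : exists v, e v = [set p].
    by apply: e_onto; apply/set0Pn; exists p; rewrite inE.
  rewrite (big_pred1 v) // => w; rewrite up /= -ev; apply/eqP/eqP => [|->//].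
  exact: e_inj.
rewrite (prod_fibers u.2 (fun _ x => phi (detset u.1 x) x)).
have -> : \prod_v \prod_(x in fiber (label u) (inr v)) (phi (detset u.1 x) x * g x) =
    \prod_x if label u x is Some (inr v) then phi (detset u.1 x) x * g x else 1.
  rewrite (exchange_big_dep xpredT) //=; apply: eq_bigr => x _.
  case lx: (label u x) => [[i|v]|].
  - by rewrite big1 // => v; rewrite inE lx.
  - rewrite (big_pred1 v) // => w; rewrite inE lx.
    by apply/eqP/eqP => [[->]|->].
  - by rewrite big1 // => v; rewrite inE lx.
set Bs := \prod_i B i _; set Cs := \prod_(p | _) clut p.
rewrite (big_mkcond (fun x => label u x == None)).
rewrite (big_mkcond (fun x => u.2 x == None)) /=.
set Ls := \prod_x _; set Ds := \prod_x _; set Es := \prod_x _.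
set Ps := \prod_x _; set Gs := \prod_x _.
(* Compared target by target: an old target contributes [phi], a PPP target [phi * g], either
   through a new Bernoulli or, with empty detection set, through the PPP. *)
have LDE : Ls * Ds * Es = Ps * Gs.
  rewrite -!big_split; apply: eq_bigr => x _ /=.
  case ux: (u.2 x) => [i|] /=.
    have /eqP -> : label u x == Some (inl i) by rewrite label_inl ux.
    by rewrite mul1r mulr1.
  case lx: (label u x) => [[i|v]|] /=.
  - by move/eqP: lx; rewrite label_inl ux.
  - by rewrite !mul1r.
  - by rewrite (label_None lx) !mulr1.
by transitivity (Ls * Ds * Es * Bs * Cs); [|rewrite LDE]; ring.
Qed.

(** Terms outside [simple] and [valid] vanish; on the rest, [to_updhyp] and [to_assoc] are mutually
    inverse and preserve weights. *)
Lemma sum_assoc_weight :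
  \sum_u assoc_weight u = \sum_(t | exact_cover t.1.1 t.1.2) upd_weight t.
Proof.
rewrite (bigID (@simple)) /= [X in _ + X]big1 ?addr0; last first.
  by move=> u; exact: assoc_weight_eq0.
rewrite [RHS](bigID valid) /= [X in _ = _ + X]big1 ?addr0; last first.
  by move=> t /andP[]; exact: upd_weight_eq0.
rewrite (eq_bigl valid) => [|t]; last first.
  by apply/andP/idP => [[]//|vt]; split=> //; case/and4P: vt.
rewrite (reindex_onto to_updhyp to_assoc) /=; last exact: to_assocK.
apply: eq_big => [u|u su]; last by rewrite upd_weight_to_updhyp.
apply/idP/andP => [su|[vu /eqP <-]]; first by rewrite valid_to_updhyp ?to_updhypK.
exact: simple_to_assoc.
Qed.

End Association.

(** * PMBM densities as sums over allocations of targets *)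

Lemma subfsP (T : ptopologicalType) (X : {fset T}) (S : {set X}) u :
  reflect (exists2 x : X, x \in S & u = val x) (u \in subfs S).
Proof.
by rewrite /subfs; apply: (iffP (imfsetP _ _ _ _)) => -[x xS ->]; exists x.
Qed.

Section SubFset.
Variables (R : realType) (T : ptopologicalType) (X : {fset T}).

Lemma mem_subfs (S : {set X}) (x : X) : (val x \in subfs S) = (x \in S).
Proof. by apply/subfsP/idP => [[y yS /val_inj ->]|xS]; [|exists x]. Qed.

Lemma card_subfs (S : {set X}) : size (subfs S : seq T) = #|S|.
Proof.
rewrite -[LHS]/(#|` subfs S|) card_imfset /=; last exact: val_inj.
by rewrite cardE.
Qed.

Lemma prod_subfs (S : {set X}) (F : T -> R) :
  \prod_(x <- subfs S) F x = \prod_(x in S) F (val x).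
Proof.
rewrite big_imfset /=; last by move=> x y _ _; exact: val_inj.
by rewrite big_enum.
Qed.

(** On a singleton the product evaluates [p] at the unique point without choosing it. *)
Lemma bern_densE (r : R) (p : T -> R) (S : {set X}) :
  bern_dens r p (subfs S) =
  if S == finset.set0 then 1 - r
  else if #|S| == 1%N then r * \prod_(x in S) p (val x) else 0.
Proof.
rewrite -cards_eq0 -(card_subfs S).
have [S1|S1] := boolP (#|S| == 1%N).
  have /cards1P[x Sx] := S1; rewrite Sx big_set1 -Sx.
  have : val x \in (subfs S : seq T) by rewrite mem_subfs Sx inE.
  move: S1; rewrite -card_subfs /bern_dens.
  by case: (enum_fset _) => [//|y [|//]] _; rewrite inE => /eqP <-.
move: S1; rewrite -card_subfs /bern_dens.
by case: (enum_fset _) => [//|y [|]].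
Qed.

(** Extending a block map on [S] by [None] gives a labelling of all of [X], which removes the
    dependence of the domain on [S]. *)
Lemma sum_decomposition (I : finType) (S : {set X}) (F : I -> {fset T} -> R) :
  \sum_(D : {ffun subfs S -> I}) \prod_i F i (subfs [set x | D x == i]) =
  \sum_(G : {ffun X -> option I} | [set x | G x == None] == finset.setC S)
     \prod_i F i (subfs [set x | G x == Some i]).
Proof.
pose h (D : {ffun subfs S -> I}) : {ffun X -> option I} :=
  [ffun x => omap D (insub (val x))].
have hE D (y : subfs S) (x : X) : val x = val y -> h D x = Some (D y).
  by move=> xy; rewrite ffunE xy valK.
have lift (y : subfs S) : {x : X | val x = val y & x \in S}.
  have yX : val y \in X by have /subfsP[x _ ->] := valP y; exact: valP.
  by exists (FSetSub yX); rewrite // -mem_subfs; exact: (valP y).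
have h_inj : injective h.
  move=> D D' DD'; apply/ffunP => y; have [x xy _] := lift y.
  by move/ffunP/(_ x): DD'; rewrite !(hE _ _ _ xy) => -[].
rewrite (eq_bigl (fun G => G \in [set h D | D in [set: {ffun subfs S -> I}]])) => [|G].
  rewrite big_imset /=; last by move=> D D' _ _; exact: h_inj.
  apply: eq_big => [D|D _]; first by rewrite inE.
  apply: eq_bigr => i _; congr (F i); apply/fsetP => u.
   apply/subfsP/subfsP => -[y]; rewrite inE => /eqP Dy ->.
    by have [x xy _] := lift y; exists x => //; rewrite inE (hE _ _ _ xy) Dy.
  move: Dy; rewrite ffunE; case: insubP => //= z _ zy [Dz].
  by exists z; rewrite // inE Dz.
apply/eqP/imsetP => [GS|[D _ ->]].
  have GD (y : subfs S) : {i | G (sval (lift y)) = Some i}.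
    case Gy: (G _) => [i|]; first by exists i.
    case: (lift y) Gy => x /= xy xS Gx; move/setP/(_ x): GS.
    by rewrite !inE xS Gx.
  exists [ffun y => sval (GD y)] => //; apply/ffunP => x; rewrite ffunE.
  case: insubP => [y _ yx|].
    rewrite /= ffunE; case: (GD y) => i /= <-; congr (G _); apply: val_inj.
    by case: (lift y) => z /= -> _.
  rewrite mem_subfs => xS; move/setP/(_ x): GS; rewrite !inE xS => /eqP.
  by [].
apply/setP => x; rewrite !inE ffunE; case: insubP => [y|].
  by rewrite mem_subfs => ->.
by rewrite mem_subfs => ->.
Qed.

End SubFset.

Section Unnormalised.
Variables (R : realType) (T : ptopologicalType).
Variable mu : {measure set (borel T) -> \bar R}.
Variables (P : pmbm R T) (Mall : {fset nat * nat}) (X : {fset T}).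

Definition hyp_weight (a : ghyp P) : R := \prod_(i < pm_n P) pm_w P i (a i).

Definition hyp_dens (a : ghyp P) : R :=
  \sum_(G : {ffun X -> option 'I_(pm_n P)})
    (\prod_(x | G x == None) pm_lam P (val x)) *
    \prod_(i < pm_n P) bern_dens (pm_r P i (a i)) (pm_p P i (a i))
                                 (subfs [set x | G x == Some i]).

(** The PPP part [Y] and the block map on its complement merge into one labelling, with [Y] the set
    labelled [None]. *)
Lemma pmbm_densE :
  pmbm_dens mu P Mall X =
  expR (- Rintegral mu [set: borel T] (pm_lam P)) *
  ((\sum_(a | is_ghyp Mall a) hyp_weight a * hyp_dens a) /
   (\sum_(a : ghyp P | is_ghyp Mall a) hyp_weight a)).
Proof.
rewrite /pmbm_dens /mbm_dens mulr_suml mulr_sumr.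
under eq_bigr => Y _ do rewrite mulr_sumr.
rewrite exchange_big /=; apply: eq_bigr => a _.
under eq_bigr => Y _ do rewrite mulrCA.
rewrite -mulr_sumr.
transitivity (gweight Mall a *
    (expR (- Rintegral mu [set: borel T] (pm_lam P)) * hyp_dens a)); last first.
  by rewrite /gweight -/(hyp_weight a); ring.
congr (_ * _); rewrite /hyp_dens mulr_sumr.
rewrite (partition_big (fun G : {ffun X -> option 'I_(pm_n P)} =>
  [set x | G x == None]) xpredT) //=.
apply: eq_bigr => Y _; 
rewrite (sum_decomposition _ (fun i : 'I_(pm_n P) =>
  bern_dens (pm_r P i (a i)) (pm_p P i (a i)))) finset.setCK mulr_sumr.
apply: eq_bigr => G /eqP GY; rewrite /ppp_dens prod_subfs -mulrA.
congr (_ * (_ * _)); rewrite -GY; apply: eq_bigl => x; by rewrite inE.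
Qed.

End Unnormalised.

(** * Global hypotheses of the update *)

(* Counting turns covering and disjointness into one additive condition, which
   splits along old and new Bernoullis. *)
Lemma is_ghypP (R : realType) (T : ptopologicalType) (P : pmbm R T) Mall (a : ghyp P) :
  reflect (forall u, (\sum_(i < pm_n P) (u \in pm_M P i (a i)))%N = (u \in Mall))
          (is_ghyp Mall a).
Proof.
apply: (iffP andP) => [[/eqP <- /forallP disj] u|H].
  have [/bigfcupP[i _ ui]|/bigfcupP nu] := boolP (u \in _).
    rewrite (bigD1 i) //= ui big1 ?addn0 // => j ji; apply/eqP; rewrite eqb0.
    have /forallP/(_ j) := disj i; rewrite eq_sym ji => /eqP/fsetP/(_ u).
    by rewrite !inE ui => /= ->.
  rewrite big1 // => i _; apply/eqP; rewrite eqb0; apply/negP => ui.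
  by apply: nu; exists i => //; rewrite mem_index_enum.
split.
  apply/eqP/fsetP => u; have := H u; case: (boolP (u \in Mall)) => _ Hu.
    have [//|/bigfcupP nu] := boolP (u \in _).
    move: Hu; rewrite big1 // => i _; apply/eqP; rewrite eqb0; apply/negP => ui.
    by apply: nu; exists i => //; rewrite mem_index_enum.
  apply/negbTE/negP => /bigfcupP[i _ ui].
  by move: Hu; rewrite (bigD1 i) //= ui.
apply/forallP => i; apply/forallP => j; apply/implyP => ij; apply/eqP/fsetP => u.
rewrite !inE; apply/negbTE/negP => /andP[ui uj].
have := H u; rewrite (bigD1 i) //= (bigD1 j) ?(eq_sym j) //= ui uj.
by case: (u \in Mall).
Qed.

(** The same counting form as for [is_ghyp], so that the two conditions can be compared. *)
Lemma exact_cover_sumP (I K M : finType) (e : K -> {set M})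
    (J : {ffun I -> {set M}}) (c : {ffun K -> bool}) :
  reflect (forall p, (\sum_i (p \in J i) + \sum_v (c v && (p \in e v)) = 1)%N)
          (exact_cover e J c).
Proof.
have E p : #|[pred t | p \in cell e J c t]| =
           (\sum_i (p \in J i) + \sum_v (c v && (p \in e v)))%N.
  rewrite -sum1_card big_mkcond big_sumType /=.
  congr (_ + _)%N; apply: eq_bigr => i _; rewrite !inE //=.
  by case: (c i); [case: (_ \in _)|rewrite inE].
by apply: (iffP forallP) => H p; [rewrite -E; apply/eqP|rewrite E; apply/eqP].
Qed.

Lemma in_Mset (mt : nat -> nat) t u :
  (u \in Mset mt t) = [&& 0 < u.1 <= t, 0 < u.2 & u.2 <= mt u.1]%N.
Proof.
case: u => a b; rewrite /Mset !inE /=.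
apply/allpairsPdep/idP => [[a' [b' [+ + [-> ->]]]]|/and3P[ha hb hb']].
  by rewrite !mem_iota; lia.
by exists a, b; rewrite !mem_iota; split => //; lia.
Qed.

Lemma in_Msub k m (S : {set 'I_m}) u :
  (u \in Msub k S) = (u.1 == k) && [exists p in S, u.2 == (val p).+1].
Proof.
case: u => a b /=; rewrite /Msub; apply/imfsetP/andP => /= [[p pS [-> ->]]|[/eqP -> ]].
  by rewrite eqxx; split => //; apply/existsP; exists p; rewrite pS /=.
by case/existsP => p /andP[pS /eqP ->]; exists p.
Qed.

Lemma in_Msub_ord k m (S : {set 'I_m}) (p : 'I_m) : ((k, p.+1) \in Msub k S) = (p \in S).
Proof.
rewrite in_Msub /= eqxx; apply/existsP/idP => [[q /andP[qS /eqP[/val_inj ->]]]//|pS].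
by exists p; rewrite pS eqxx.
Qed.

(** * Numbering of the subsets of the measurement set *)

Section SubsetEnumeration.
Variables (m : nat) (E : nat -> {set 'I_m}).
Hypothesis E_neq0 : forall j, (1 <= j <= 2 ^ m - 1)%N -> E j != finset.set0.
Hypothesis E_inj : forall j1 j2, (1 <= j1 <= 2 ^ m - 1)%N ->
  (1 <= j2 <= 2 ^ m - 1)%N -> E j1 = E j2 -> j1 = j2.

(** Ordinals start at 0 while the nonempty subsets are numbered from 1, hence the successor. The
    number 0 is kept below for the empty set. *)
Definition enum_subset (v : 'I_(2 ^ m - 1)) : {set 'I_m} := E v.+1.

Definition subset_index (S : {set 'I_m}) : nat :=
  if [pick v | enum_subset v == S] is Some v then v.+1 else 0.

Definition subset_of (j : nat) : {set 'I_m} :=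
  if j == 0 then finset.set0 else E j.

Lemma enum_subset_inj : injective enum_subset.
Proof.
move=> v w /E_inj H; apply: val_inj; apply: succn_inj.
by apply: H; rewrite /= ltn_ord.
Qed.

Lemma enum_subset_neq0 v : enum_subset v != finset.set0.
Proof. by apply: E_neq0; rewrite /= ltn_ord. Qed.

(** Pigeonhole: the [2 ^ m - 1] listed sets, the empty set and an unlisted [S] would be [2 ^ m + 1]
    distinct subsets. *)
Lemma enum_subset_onto S : S != finset.set0 -> exists v, enum_subset v = S.
Proof.
move=> S0; have [|] := boolP (S \in [set enum_subset v | v in 'I_(2 ^ m - 1)]).
  by case/imsetP => v _ ->; exists v.
set A := [set _ | _ in _] => SA; have cA : #|A| = (2 ^ m - 1)%N.
  by rewrite card_imset ?card_ord //; exact: enum_subset_inj.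
have A0 : finset.set0 \notin A.
  by apply/imsetP => -[v _ /esym/eqP]; exact/negP/enum_subset_neq0.
have : (#|S |: (finset.set0 |: A)| <= 2 ^ m)%N.
  by rewrite -[in leqRHS](card_ord m) -cardsT -card_powerset subset_leq_card //
    finset.powersetT finset.subsetT.
by rewrite !cardsU1 !inE (negPf S0) SA A0 cA /=; lia.
Qed.

Lemma subset_index_lt S : (subset_index S < 2 ^ m)%N.
Proof.
rewrite /subset_index; case: pickP => [v _|_]; last by rewrite expn_gt0.
by have := ltn_ord v; lia.
Qed.

Lemma subset_indexK S : subset_of (subset_index S) = S.
Proof.
rewrite /subset_index /subset_of; case: pickP => [v /eqP <- //|no] /=.
apply/esym/eqP; apply: contraT => /enum_subset_onto[v ev].
by have := no v; rewrite ev eqxx.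
Qed.

Lemma subset_ofK j : (j < 2 ^ m)%N -> subset_index (subset_of j) = j.
Proof.
rewrite /subset_index /subset_of; case: j => [_|j lj] /=.
  by case: pickP => // v; rewrite (negPf (enum_subset_neq0 v)).
have lj' : (j < 2 ^ m - 1)%N by lia.
case: pickP => [v /eqP ev|/(_ (Ordinal lj'))]; last by rewrite eqxx.
by have -> : v = Ordinal lj' by apply: enum_subset_inj.
Qed.

Lemma subset_index_eq0 S : (subset_index S == 0%N) = (S == finset.set0).
Proof.
apply/eqP/eqP => [S0|->]; first by rewrite -(subset_indexK S) S0.
exact: (@subset_ofK 0 (expn_gt0 _ _)).
Qed.

End SubsetEnumeration.

(** * Encoding of updated global hypotheses as triples *)

Section UpdatedHypotheses.
Variables (R : realType) (T : ptopologicalType) (nz : nat).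
Variable mu : {measure set (borel T) -> \bar R}.
Variables (f : {fset 'rV[R]_nz} -> T -> R) (lamC : 'rV[R]_nz -> R).
Variables (k m : nat) (z : 'I_m -> 'rV[R]_nz) (E : nat -> {set 'I_m}).
Hypothesis E_neq0 : forall j, (1 <= j <= 2 ^ m - 1)%N -> E j != finset.set0.
Hypothesis E_inj : forall j1 j2, (1 <= j1 <= 2 ^ m - 1)%N ->
  (1 <= j2 <= 2 ^ m - 1)%N -> E j1 = E j2 -> j1 = j2.
Variable P : pmbm R T.

Local Notation n := (pm_n P).
Local Notation K := 'I_(2 ^ m - 1).
Local Notation P' := (pmbm_update mu f lamC k z E P).
Let triple := (ghyp P * ({ffun 'I_n -> {set 'I_m}} * {ffun K -> bool}))%type.

(* Old Bernoullis encode the pair (prior hypothesis, measurement set) in base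
   [pm_h P i], with digit 0 for the missed detection. *)
Definition hyp_code (t : triple) (i : 'I_(n + (2 ^ m - 1))) : nat :=
  match fintype.split i with
  | inl i0 => t.1 i0 + pm_h P i0 * subset_index E (t.2.1 i0)
  | inr v => t.2.2 v
  end.

Lemma hyp_code_lt t (i : 'I_(n + (2 ^ m - 1))) : (hyp_code t i < pm_h P' i)%N.
Proof.
rewrite /hyp_code /=; case: splitP => [i0 ->|v _]; last by case: (t.2.2 v).
have code_lt h b s w : (b < h -> s < w -> b + h * s < w * h)%N by nia.
exact: code_lt (ltn_ord _) (subset_index_lt _ _).
Qed.

Definition mk_hyp (t : triple) : ghyp P' :=
  [ffun i : 'I_(pm_n P') => Ordinal (hyp_code_lt t i)].

Lemma mk_hyp_lshift t i : mk_hyp t (lshift _ i) =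
  (t.1 i + pm_h P i * subset_index E (t.2.1 i))%N :> nat.
Proof. by rewrite ffunE /= /hyp_code (unsplitK (inl i)). Qed.

Lemma mk_hyp_rshift t v : mk_hyp t (rshift _ v) = t.2.2 v :> nat.
Proof. by rewrite ffunE /= /hyp_code (unsplitK (inr v)). Qed.

Lemma ghyp_lshift_lt (a : ghyp P') (i : 'I_n) :
  (a (lshift _ i) < 2 ^ m * pm_h P i)%N.
Proof. by case: (a (lshift _ i)) => x /= xh; move: xh; rewrite (ltn_ord i). Qed.

Lemma ghyp_rshift_lt (a : ghyp P') (v : K) : (a (rshift _ v) < 2)%N.
Proof.
by case: (a (rshift _ v)) => x /= xh; move: xh; rewrite [(_ + _ < _)%N]ltnNge leq_addr.
Qed.

(** [a] provides a number below [2 ^ m * pm_h P i], so [pm_h P i] is positive. *)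
Lemma old_hyp_lt (a : ghyp P') (i : 'I_n) :
  (a (lshift _ i) %% pm_h P i < pm_h P i)%N.
Proof.
rewrite ltn_mod; have := ghyp_lshift_lt a i.
by case: (pm_h P i) => //; rewrite muln0.
Qed.

Definition split_hyp (a : ghyp P') : triple :=
  ([ffun i : 'I_n => Ordinal (old_hyp_lt a i)],
   ([ffun i : 'I_n => subset_of E (a (lshift _ i) %/ pm_h P i)],
    [ffun v : K => a (rshift _ v) == 1%N :> nat])).

Lemma mk_hyp_mod t i : (mk_hyp t (lshift _ i) %% pm_h P i)%N = t.1 i.
Proof. by rewrite mk_hyp_lshift addnC mulnC modnMDl modn_small. Qed.

Lemma mk_hyp_div t i : (mk_hyp t (lshift _ i) %/ pm_h P i)%N =
  subset_index E (t.2.1 i).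
Proof.
rewrite mk_hyp_lshift addnC mulnC divnMDl ?divn_small ?addn0 //.
exact: leq_ltn_trans (ltn_ord (t.1 i)).
Qed.

Lemma mk_hypK : cancel mk_hyp split_hyp.
Proof.
move=> [b [J c]]; congr (_, (_, _)); apply/ffunP => i; rewrite ffunE.
- by apply: val_inj; rewrite /= mk_hyp_mod.
- by rewrite mk_hyp_div subset_indexK.
- by rewrite mk_hyp_rshift /=; case: (c i).
Qed.

Lemma split_hypK : cancel split_hyp mk_hyp.
Proof.
move=> a; apply/ffunP => i; apply: val_inj; rewrite -[i](@splitK n (2 ^ m - 1)).
case: (fintype.split i) => [i0|v]; rewrite [unsplit _]/=.
  rewrite [LHS]mk_hyp_lshift /= !ffunE /= subset_ofK //.
    by rewrite addnC mulnC -divn_eq.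
  rewrite ltn_divLR ?ghyp_lshift_lt //.
  exact: leq_ltn_trans (old_hyp_lt a i0).
rewrite [LHS]mk_hyp_rshift /= ffunE.
by have := ghyp_rshift_lt a v; case: (nat_of_ord _) => [|[|]].
Qed.

End UpdatedHypotheses.

(** * Measurement pairs of the updated hypotheses *)

Section UpdatedParameters.
Variables (R : realType) (T : ptopologicalType) (nz : nat).
Variable mu : {measure set (borel T) -> \bar R}.
Variables (f : {fset 'rV[R]_nz} -> T -> R) (lamC : 'rV[R]_nz -> R).
Variables (k : nat) (mt : nat -> nat).
Local Notation m := (mt k).
Variables (z : 'I_m -> 'rV[R]_nz) (E : nat -> {set 'I_m}).
Variable P : pmbm R T.
Hypothesis k_gt0 : (0 < k)%N.
Hypothesis E_neq0 : forall j, (1 <= j <= 2 ^ m - 1)%N -> E j != finset.set0.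
Hypothesis E_inj : forall j1 j2, (1 <= j1 <= 2 ^ m - 1)%N ->
  (1 <= j2 <= 2 ^ m - 1)%N -> E j1 = E j2 -> j1 = j2.

Local Notation n := (pm_n P).
Local Notation K := 'I_(2 ^ m - 1).
Local Notation P' := (pmbm_update mu f lamC k z E P).
Local Notation triple :=
  (ghyp P * ({ffun 'I_n -> {set 'I_m}} * {ffun K -> bool}))%type.
Local Notation mk_hyp := (mk_hyp mu f lamC k z E).
Implicit Types (t : triple) (i : 'I_n) (v : K).

Lemma rshift_ltF v : (n + v < n)%N = false.
Proof. by rewrite ltnNge leq_addr. Qed.

Lemma rshift_index v : (n + v - n + 1)%N = v.+1.
Proof. by rewrite addKn addn1. Qed.

Lemma Zsub0 : Zsub z finset.set0 = fset0.
Proof.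
by apply/fsetP => y; rewrite /Zsub inE; apply/imfsetP => -[p]; rewrite /= inE.
Qed.

Lemma E_subset_index S : S != finset.set0 -> E (subset_index E S) = S.
Proof.
move=> S0; rewrite -[RHS](subset_indexK E_neq0 E_inj) /subset_of.
by rewrite (subset_index_eq0 E_neq0 E_inj) (negPf S0).
Qed.

(** [Msub] of the empty set is empty, so missed detection and detection share one formula. *)
Lemma mem_M_lshift t i u :
  (u \in pm_M P' (lshift (2 ^ m - 1) i) (mk_hyp t (lshift _ i))) =
  (u \in pm_M P i (t.1 i)) || (u \in Msub k (t.2.1 i)).
Proof.
have := mk_hyp_mod mu f lamC k z E t i; have := mk_hyp_div mu f lamC k z E t i.
move: (nat_of_ord (mk_hyp t _)) => a; rewrite /= (ltn_ord i) => -> ->.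
rewrite (subset_index_eq0 E_neq0 E_inj).
case: ifPn => [/eqP ->|J0]; last by rewrite E_subset_index // inE.
by rewrite in_Msub; case: existsP => [[p]|]; rewrite ?inE ?andbF ?orbF.
Qed.

Lemma mem_M_rshift t v u :
  (u \in pm_M P' (rshift n v) (mk_hyp t (rshift n v))) =
  t.2.2 v && (u \in Msub k (enum_subset E v)).
Proof.
have := mk_hyp_rshift mu f lamC k z E t v; move: (nat_of_ord (mk_hyp t _)) => a.
rewrite /= rshift_ltF rshift_index => ->.
by case: (t.2.2 v) => //=; rewrite inE.
Qed.

Section Hypotheses.
Hypothesis M_sub : forall i a : nat, (i < n)%N -> (a < pm_h P i)%N ->
  (pm_M P i a `<=` Mset mt k.-1)%fset.

(** The counting condition splits by time: pairs of time [k] occur only in the [Msub] parts, because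
    prior sets lie in [Mset mt k.-1], and all other pairs occur only in the prior sets. *)
Lemma is_ghyp_mk_hyp t :
  is_ghyp (Mset mt k) (mk_hyp t) =
  is_ghyp (Mset mt k.-1) t.1 && exact_cover (enum_subset E) t.2.1 t.2.2.
Proof.
pose cnt (u : nat * nat) :=
  (\sum_(i < n) ((u \in pm_M P i (t.1 i)) || (u \in Msub k (t.2.1 i))) +
   \sum_(v : K) (t.2.2 v && (u \in Msub k (enum_subset E v))))%N.
have cntE u : (\sum_(i < pm_n P') (u \in pm_M P' i (mk_hyp t i)))%N = cnt u.
  rewrite /cnt big_split_ord /=.
  by congr (_ + _)%N; apply: eq_bigr => i _; rewrite ?mem_M_lshift ?mem_M_rshift.
have Mk u (i : 'I_n) : u \in pm_M P i (t.1 i) -> u.1 != k.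
  have /fsubsetP H := M_sub (ltn_ord i) (ltn_ord (t.1 i)).
  by move/H; rewrite in_Mset; lia.
have MkF u i : u.1 = k -> (u \in pm_M P i (t.1 i)) = false.
  by move=> uk; apply: contra_eqF uk => /Mk.
have cnt_past u : u.1 != k -> cnt u = (\sum_(i < n) (u \in pm_M P i (t.1 i)))%N.
  move=> uk; rewrite /cnt [X in (_ + X)%N]big1 ?addn0 => [|v _].
    by apply: eq_bigr => i _; rewrite in_Msub (negPf uk) orbF.
  by rewrite in_Msub (negPf uk) andbF.
have Mset_past u : u.1 != k -> (u \in Mset mt k) = (u \in Mset mt k.-1).
  move: u => [a b] /= ak; rewrite !in_Mset /=.
  by have -> : (a <= k)%N = (a <= k.-1)%N by lia.
have Mset_k u : u.1 = k -> (u \in Mset mt k.-1) = false.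
  by move=> uk; rewrite in_Mset uk; lia.
have cnt_k (p : 'I_m) : cnt (k, p.+1) =
    (\sum_i (p \in t.2.1 i) + \sum_v (t.2.2 v && (p \in enum_subset E v)))%N.
  congr (_ + _)%N; apply: eq_bigr => i _; rewrite in_Msub_ord //.
  by rewrite MkF.
apply/is_ghypP/andP => [H|[/is_ghypP Hb /exact_cover_sumP Hc] u].
  have {}H u : cnt u = (u \in Mset mt k) by rewrite -cntE H.
  split.
    apply/is_ghypP => u; have [uk|uk] := eqVneq u.1 k; last first.
      by rewrite -cnt_past // H Mset_past.
    rewrite Mset_k // big1 // => i _; by rewrite MkF.
  apply/exact_cover_sumP => p; rewrite -cnt_k H in_Mset /=.
  by have := ltn_ord p; rewrite k_gt0 leqnn /= => ->.
rewrite cntE; have [uk|uk] := eqVneq u.1 k; last by rewrite cnt_past // Hb Mset_past.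
have [um|um] := boolP ((0 < u.2) && (u.2 <= m))%N.
  have pm : (u.2.-1 < m)%N by lia.
  have -> : u = (k, (Ordinal pm).+1).
    by case: u uk um pm => a b /= -> /andP[? _] ?; rewrite prednK.
  by rewrite cnt_k Hc in_Mset /= pm k_gt0 leqnn.
(* A pair of time [k] with index outside [1..m] is in no local hypothesis and not in [Mset mt k]. *)
have uMs (S : {set 'I_m}) : (u \in Msub k S) = false.
  rewrite in_Msub; apply/negbTE/negP => /andP[_ /existsP[p /andP[_ /eqP up]]].
  by move: um; rewrite up /= ltn_ord.
rewrite /cnt !big1 => [|v _|i _]; rewrite ?uMs ?andbF ?orbF.
- by rewrite in_Mset uk (negPf um) andbF.
- by [].
- by rewrite MkF.
Qed.

End Hypotheses.
End UpdatedParameters.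

(** * Weights of the update *)

Lemma bern_dens_card_gt1 (R : realType) (T : ptopologicalType) (X : {fset T})
    (r : R) (p : T -> R) (V : {set X}) :
  (1 < #|V|)%N -> bern_dens r p (subfs V) = 0.
Proof.
by move=> V1; rewrite bern_densE -cards_eq0 !gtn_eqF // ltnW.
Qed.

(** Each local weight is paired with its Bernoulli density, because the normalising inner products
    cancel within this pair. *)
Lemma hyp_weight_dens (R : realType) (T : ptopologicalType) (P : pmbm R T)
    (X : {fset T}) (a : ghyp P) :
  hyp_weight a * hyp_dens X a =
  \sum_(G : {ffun X -> option 'I_(pm_n P)})
    (\prod_(x | G x == None) pm_lam P (val x)) *
    \prod_(i < pm_n P) (pm_w P i (a i) *
       bern_dens (pm_r P i (a i)) (pm_p P i (a i)) (subfs (fiber G i))).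
Proof.
rewrite /hyp_weight /hyp_dens mulr_sumr; apply: eq_bigr => G _.
by rewrite mulrCA big_split.
Qed.

Lemma inner_ge0 (R : realType) (T : ptopologicalType)
    (mu : {measure set (borel T) -> \bar R}) (a b : T -> R) :
  (forall x, 0 <= a x) -> (forall x, 0 <= b x) -> 0 <= inner mu a b.
Proof.
move=> a0 b0; apply: fine_ge0; apply: integral_ge0 => x _.
by rewrite lee_fin mulr_ge0.
Qed.

(** * Cancellation of possibly zero normalisers *)

Section ScalarIdentities.
Variable R : realFieldType.
Implicit Types w r l F c : R.

(** A zero denominator is a sum of two nonnegative terms, so [1 - r = 0] and both sides vanish. *)
Lemma missed_mass_empty w r l : 0 <= r <= 1 -> 0 <= l ->
  w * (1 - r + r * l) * (1 - r * l / (1 - r + r * l)) = w * (1 - r).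
Proof.
move=> /andP[r0 r1] l0; have [d0|d0] := eqVneq (1 - r + r * l) 0.
  have rl0 := mulr_ge0 r0 l0; have r10 : 1 - r = 0 by lra.
  by rewrite d0 r10 !mulr0 mul0r.
by field.
Qed.

Lemma missed_mass_single w r l F : 0 <= r <= 1 -> 0 <= l -> (l = 0 -> F = 0) ->
  w * (1 - r + r * l) * (r * l / (1 - r + r * l) * (F / l)) = w * r * F.
Proof.
move=> /andP[r0 r1] l0 F0; have [l00|l00] := eqVneq l 0.
  by rewrite F0 // l00 !(mul0r, mulr0).
have [d0|d0] := eqVneq (1 - r + r * l) 0; last by field; rewrite l00.
have rl0 := mulr_ge0 r0 l0.
(* With [l] nonzero this gives [r = 0], and the denominator would be 1. *)
have /eqP : r * l = 0 by lra.
rewrite mulf_eq0 (negPf l00) orbF => /eqP r00.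
by move: d0; rewrite r00 => ?; lra.
Qed.

Lemma detected_mass_single w r l F : (l = 0 -> F = 0) ->
  w * r * l * (1 * (F / l)) = w * r * F.
Proof.
move=> F0; have [l0|l0] := eqVneq l 0; last by field.
by rewrite F0 // l0 !(mul0r, mulr0).
Qed.

Lemma new_mass_empty c l : 0 <= c -> 0 <= l -> (c + l) * (1 - l / (c + l)) = c.
Proof.
move=> c0 l0; have [d0|d0] := eqVneq (c + l) 0; last by field.
by rewrite d0 mul0r; lra.
Qed.

Lemma new_mass_single c l F : 0 <= c -> 0 <= l -> (l = 0 -> F = 0) ->
  (c + l) * (l / (c + l) * (F / l)) = F.
Proof.
move=> c0 l0 F0; have [l00|l00] := eqVneq l 0.
  by rewrite F0 // l00 !(mul0r, mulr0).
by field; rewrite l00 /= gt_eqF // ltr_wpDl // lt_neqAle eq_sym l00.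
Qed.

End ScalarIdentities.

(** * Local updates and the unnormalised update identity *)

Section UpdatedDensity.
Variables (R : realType) (T : ptopologicalType) (nz : nat).
Variable mu : {measure set (borel T) -> \bar R}.
Variables (f : {fset 'rV[R]_nz} -> T -> R) (lamC : 'rV[R]_nz -> R).
Variables (k : nat) (mt : nat -> nat).
Local Notation m := (mt k).
Variables (z : 'I_m -> 'rV[R]_nz) (E : nat -> {set 'I_m}).
Variable P : pmbm R T.
Hypothesis k_gt0 : (0 < k)%N.
Hypothesis E_neq0 : forall j, (1 <= j <= 2 ^ m - 1)%N -> E j != finset.set0.
Hypothesis E_inj : forall j1 j2, (1 <= j1 <= 2 ^ m - 1)%N ->
  (1 <= j2 <= 2 ^ m - 1)%N -> E j1 = E j2 -> j1 = j2.
Hypothesis f_ge0 : forall Z x, 0 <= f Z x.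
Hypothesis lamC_ge0 : forall y, 0 <= lamC y.
Hypothesis lam_ge0 : forall x, 0 <= pm_lam P x.

Local Notation n := (pm_n P).
Local Notation K := 'I_(2 ^ m - 1).
Local Notation P' := (pmbm_update mu f lamC k z E P).
Local Notation triple :=
  (ghyp P * ({ffun 'I_n -> {set 'I_m}} * {ffun K -> bool}))%type.
Local Notation mk_hyp := (@mk_hyp R T nz mu f lamC k m z E P).

Hypothesis w_ge0 : forall i a, (i < n)%N -> (a < pm_h P i)%N -> 0 <= pm_w P i a.
Hypothesis r_01 : forall i a, (i < n)%N -> (a < pm_h P i)%N -> 0 <= pm_r P i a <= 1.
Hypothesis p_ge0 : forall i a, (i < n)%N -> (a < pm_h P i)%N ->
  forall x, 0 <= pm_p P i a x.
Hypothesis M_sub : forall i a, (i < n)%N -> (a < pm_h P i)%N ->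
  (pm_M P i a `<=` Mset mt k.-1)%fset.

(** The states at which dividing by a zero inner product does no harm. Only finitely many inner
    products are involved, so almost every state qualifies. *)
Definition regular_state (x : T) : Prop :=
  (forall S i a, (i < n)%N -> (a < pm_h P i)%N ->
     inner mu (pm_p P i a) (f (Zsub z S)) = 0 -> pm_p P i a x * f (Zsub z S) x = 0) /\
  (forall S, inner mu (pm_lam P) (f (Zsub z S)) = 0 ->
     pm_lam P x * f (Zsub z S) x = 0).

Variable X : {fset T}.
Hypothesis X_regular : forall x, x \in X -> regular_state x.

Let phi (S : {set 'I_m}) (x : X) := f (Zsub z S) (val x).
Let g (x : X) := pm_lam P (val x).
Let clut (p : 'I_m) := lamC (z p).

Lemma old_bernoulli_update (t : triple) (i : 'I_n) (V : {set X}) :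
  let a' := mk_hyp t (lshift _ i) in
  pm_w P' (lshift (2 ^ m - 1) i) a' *
    bern_dens (pm_r P' (lshift (2 ^ m - 1) i) a')
              (pm_p P' (lshift (2 ^ m - 1) i) a') (subfs V) =
  pm_w P i (t.1 i) * bern_dens (pm_r P i (t.1 i)) (pm_p P i (t.1 i)) (subfs V) *
  old_factor phi (t.2.1 i) V.
Proof.
move=> /=; rewrite !bern_densE /old_factor.
have := mk_hyp_mod mu f lamC k z E t i; have := mk_hyp_div mu f lamC k z E t i.
move: (nat_of_ord (mk_hyp t _)) => a; rewrite /= (ltn_ord i) => -> ->.
set b := nat_of_ord (t.1 i); set S := t.2.1 i.
have bP : (b < pm_h P i)%N := ltn_ord _.
have l_ge0 S' : 0 <= inner mu (pm_p P i b) (f (Zsub z S')).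
  by apply: inner_ge0 => // x; exact: p_ge0.
(* Regularity of the targets settles the zero case: a zero normaliser comes with a zero
   numerator. *)
have F0 (x : X) S' : inner mu (pm_p P i b) (f (Zsub z S')) = 0 ->
    f (Zsub z S') (val x) * pm_p P i b (val x) = 0.
  by rewrite mulrC; apply: (X_regular (valP x)).1.
rewrite (subset_index_eq0 E_neq0 E_inj).
case: ifPn => [/eqP S0|S0].
  rewrite -(Zsub0 z) S0; case: ifPn => _.
    by rewrite mulr1 missed_mass_empty // r_01.
  case: ifPn => [/cards1P[x ->]|_]; last by rewrite !(mulr0, mul0r).
  rewrite !big_set1 missed_mass_single ?r_01 //; last exact: F0.
  by rewrite /phi; ring.
(* After a detection the existence probability is 1, so the empty set has mass 0. *)
rewrite (E_subset_index E_neq0 E_inj S0); case: ifPn => _.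
  by rewrite subrr !mulr0.
case: ifPn => [/cards1P[x ->]|_]; last by rewrite !(mulr0, mul0r).
rewrite !big_set1 detected_mass_single; last exact: F0.
by rewrite /phi; ring.
Qed.

(** The weight of an active new Bernoulli is clutter term plus detection term; the empty set
    receives the former and a single target the latter. *)
Lemma new_bernoulli_update (t : triple) (v : K) (V : {set X}) :
  let a' := mk_hyp t (rshift _ v) in
  pm_w P' (rshift n v) a' *
    bern_dens (pm_r P' (rshift n v) a') (pm_p P' (rshift n v) a') (subfs V) =
  new_factor (enum_subset E) g phi clut v (t.2.2 v) V.
Proof.
move=> /=; rewrite !bern_densE /new_factor.
have := mk_hyp_rshift mu f lamC k z E t v; move: (nat_of_ord (mk_hyp t _)) => a.
rewrite /= rshift_ltF rshift_index -/(enum_subset E v) => ->.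
case: (t.2.2 v) => /=; last first.
  by case: ifP => _; rewrite ?subr0 ?mulr1 // mul0r if_same mulr0.
have l_ge0 : 0 <= inner mu (pm_lam P) (f (Zsub z (enum_subset E v))) by exact: inner_ge0.
have -> : (if #|enum_subset E v| == 1%N then 1 else 0) =
    (#|enum_subset E v| == 1%N)%:R :> R by case: ifP.
have c_ge0 : 0 <= (#|enum_subset E v| == 1%N)%:R *
    \prod_(q in enum_subset E v) lamC (z q).
  by apply: mulr_ge0; [exact: ler0n|apply: prodr_ge0].
case: (V == finset.set0); first by rewrite new_mass_empty.
case: ifPn => [/cards1P[x ->]|_]; last by rewrite mulr0 mul0r.
rewrite !big_set1 new_mass_single ?mul1r //.
by rewrite mulrC; apply: (X_regular (valP x)).2.
Qed.

Lemma sum_updated_hyp :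
  \sum_(a | is_ghyp (Mset mt k) a) hyp_weight a * hyp_dens X (a : ghyp P') =
  (\sum_(D : {ffun 'I_m -> option X})
     (\prod_(p | D p == None) clut p) * \prod_x phi (detset D x) x) *
  \sum_(b | is_ghyp (Mset mt k.-1) b) hyp_weight b * hyp_dens X (b : ghyp P).
Proof.
(* An updated global hypothesis is a prior one together with an exact cover of the measurements. *)
rewrite (reindex_onto mk_hyp (@split_hyp _ _ _ mu f lamC k m z E P)); last first.
  by move=> a _; exact: split_hypK.
rewrite (eq_bigl (fun t : triple => is_ghyp (Mset mt k.-1) t.1 &&
    exact_cover (enum_subset E) t.2.1 t.2.2)); last first.
  by move=> t; rewrite mk_hypK // eqxx andbT; exact: is_ghyp_mk_hyp.
transitivity (\sum_(b | is_ghyp (Mset mt k.-1) b)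
    \sum_(u | exact_cover (enum_subset E) u.1 u.2)
      hyp_weight (mk_hyp (b, u)) * hyp_dens X (mk_hyp (b, u))).
  by rewrite pair_big_dep /=; apply: eq_bigr => -[].
rewrite mulr_sumr; apply: eq_bigr => b _.
pose B (i : 'I_n) (V : {set X}) := pm_w P i (b i) *
  bern_dens (pm_r P i (b i)) (pm_p P i (b i)) (subfs V).
have B1 i (V : {set X}) : (1 < #|V|)%N -> B i V = 0.
  by move=> V1; rewrite /B bern_dens_card_gt1 ?mulr0.
have core := sum_assoc_weight (enum_subset_inj E_inj) (enum_subset_neq0 E_neq0)
  (enum_subset_onto E_neq0 E_inj) g phi clut B1.
transitivity (\sum_(u : {ffun 'I_m -> option X} * {ffun X -> option 'I_n})
    assoc_weight g phi clut B u); last first.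
  rewrite hyp_weight_dens mulr_suml.
  under [RHS]eq_bigr => D _ do rewrite mulr_sumr.
  by rewrite pair_bigA /=; apply: eq_bigr.
rewrite core.
transitivity (\sum_(u | exact_cover (enum_subset E) u.1 u.2)
    \sum_G upd_weight (enum_subset E) g phi clut B (u, G)); last first.
  rewrite pair_big_dep /=.
  by apply: eq_big => [t|[u G] _]; rewrite ?andbT.
apply: eq_bigr => -[J c] _; rewrite hyp_weight_dens.
(* [h] and [h'] only rename labels, between the sum type and the concatenated range of Bernoulli
   indices. *)
pose h (G : {ffun X -> option ('I_n + K)}) :
    {ffun X -> option 'I_(n + (2 ^ m - 1))} :=
  [ffun x => omap unsplit (G x)].
pose h' (G : {ffun X -> option 'I_(n + (2 ^ m - 1))}) :
    {ffun X -> option ('I_n + K)} :=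
  [ffun x => omap fintype.split (G x)].
rewrite (reindex_onto h h'); last first.
  move=> G _; apply/ffunP => x; rewrite !ffunE.
  by case: (G x) => //= i; rewrite splitK.
apply: eq_big => [G|G _].
  apply/eqP/ffunP => x; rewrite !ffunE.
  by case: (G x) => //= i; rewrite unsplitK.
have hfib i : fiber (h G) (unsplit i) = fiber G i.
  apply/setP => x; rewrite !inE ffunE; case: (G x) => [j|] //=.
  by rewrite !(inj_eq Some_inj) (inj_eq (can_inj unsplitK)).
rewrite big_split_ord /= /upd_weight -mulrA; congr (_ * (_ * _)).
- apply: eq_big => [x|x _]; first by rewrite ffunE; case: (G x).
  by rewrite -(Zsub0 z).
- by apply: eq_bigr => i _; rewrite (hfib (inl i)) old_bernoulli_update.
- by apply: eq_bigr => v _; rewrite (hfib (inr v)) new_bernoulli_update.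
Qed.

(** Nonnegativity lets a vanishing total weight force every single weight to vanish. *)
Lemma updated_hyp_weight_ge0 (a : ghyp P') : 0 <= hyp_weight a.
Proof.
rewrite -(split_hypK E_neq0 E_inj a); move: (split_hyp _) => t.
rewrite /hyp_weight big_split_ord /=; apply: mulr_ge0; apply: prodr_ge0 => i _.
  have := mk_hyp_mod mu f lamC k z E t i; move: (nat_of_ord (mk_hyp t _)) => a0.
  rewrite (ltn_ord i) => ->; have bP := ltn_ord (t.1 i).
  have /andP[r0 r1] := r_01 (ltn_ord i) bP.
  have l_ge0 Z : 0 <= inner mu (pm_p P i (t.1 i)) (f Z).
    by apply: inner_ge0 => // x; exact: p_ge0.
  case: ifP => _; rewrite !mulr_ge0 ?w_ge0 //.
  by rewrite addr_ge0 ?subr_ge0 ?mulr_ge0.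
have := mk_hyp_rshift mu f lamC k z E t i; move: (nat_of_ord (mk_hyp t _)) => a0 _.
rewrite rshift_ltF; case: ifP => // _; rewrite addr_ge0 ?inner_ge0 //.
by apply: mulr_ge0; [case: ifP|apply: prodr_ge0].
Qed.

End UpdatedDensity.

(** * Null sets and normalisation *)

Lemma ae_inner_eq0 (R : realType) (T : ptopologicalType)
    (mu : {measure set (borel T) -> \bar R}) (a b : T -> R) :
  (forall x, 0 <= a x) -> (forall x, 0 <= b x) ->
  mu.-integrable [set: borel T] (fun x => (a x * b x)%:E) ->
  {ae mu, forall x, inner mu a b = 0 -> a x * b x = 0}.
Proof.
move=> a0 b0 iab; have [ab0|ab0] := eqVneq (inner mu a b) 0; last first.
  by apply: aeW => x ab; rewrite ab eqxx in ab0.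
have int0 : (\int[mu]_x `|(a x * b x)%:E| = 0)%E.
  under eq_integral => x _ do rewrite gee0_abs ?lee_fin ?mulr_ge0 //.
  (* Integrability makes the integral finite, so [inner], a real number read off by [fine],
     determines it. *)
  by rewrite -[LHS]fineK ?integrable_fin_num // -[fine _]/(inner mu a b) ab0.
have mab := measurable_int mu iab.
have /(ae_eq_integral_abs mu measurableT mab) ab_ae0 := int0.
by apply: filterS ab_ae0 => x /(_ I) [->].
Qed.

Lemma meas_likE (R : realType) (T : ptopologicalType) (nz : nat)
    (nu : {measure set (borel 'rV[R]_nz) -> \bar R})
    (f : {fset 'rV[R]_nz} -> T -> R) (lamC : 'rV[R]_nz -> R) (m : nat)
    (z : 'I_m -> 'rV[R]_nz) (X : {fset T}) :
  meas_lik nu f lamC z X =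
  expR (- Rintegral nu [set: borel 'rV[R]_nz] lamC) *
  \sum_(D : {ffun 'I_m -> option X})
    (\prod_(p | D p == None) lamC (z p)) *
    \prod_x f (Zsub z (detset D x)) (val x).
Proof.
rewrite /meas_lik mulr_sumr; apply: eq_bigr => D _; rewrite /clutter_dens -mulrA.
by congr (_ * (_ * _)); apply: eq_bigl => p; rewrite inE.
Qed.

Theorem theorem1
  (R : realType) (T : ptopologicalType) (nz : nat)
  (* single-target state space: locally compact, Hausdorff, second countable,
     with reference measure mu on its Borel sets *)
  (HT2 : hausdorff_space T) (HLC : locally_compact [set: T])
  (HSC : @second_countable T)
  (mu : {measure set (borel T) -> \bar R})
  (* reference measure on the measurement space R^nz *)
  (nu : {measure set (borel 'rV[R]_nz) -> \bar R})
  (* measurement model: f(Z | x) and clutter intensity lamC *)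
  (f : {fset 'rV[R]_nz} -> T -> R) (lamC : 'rV[R]_nz -> R)
  (* time step k >= 1, numbers of measurements mt t, Z_k = {z p} *)
  (k : nat) (mt : nat -> nat) (z : 'I_(mt k) -> 'rV[R]_nz)
  (* enumeration Z_k^j = {z p | p in E j}, 1 <= j <= 2^{m_k} - 1, of the
     nonempty subsets of Z_k *)
  (E : nat -> {set 'I_(mt k)})
  (* predicted PMBM parameters *)
  (P : pmbm R T) :
  (0 < k)%N ->
  injective z ->
  (forall j, (1 <= j <= 2 ^ mt k - 1)%N -> E j != finset.set0) ->
  (forall j1 j2, (1 <= j1 <= 2 ^ mt k - 1)%N -> (1 <= j2 <= 2 ^ mt k - 1)%N ->
     E j1 = E j2 -> j1 = j2) ->
  (* f(. | x) is a nonnegative (Borel measurable in x) density *)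
  (forall Z x, 0 <= f Z x) ->
  (forall Z, measurable_fun [set: borel T] (f Z)) ->
  (* clutter intensity *)
  (forall y, 0 <= lamC y) ->
  nu.-integrable [set: borel 'rV[R]_nz] (EFin \o lamC) ->
  (* predicted PPP intensity *)
  (forall x, 0 <= pm_lam P x) ->
  mu.-integrable [set: borel T] (EFin \o pm_lam P) ->
  (* predicted Bernoulli components *)
  (forall i a, (i < pm_n P)%N -> (a < pm_h P i)%N ->
     [/\ 0 <= pm_w P i a, 0 <= pm_r P i a <= 1,
         (forall x, 0 <= pm_p P i a x) &
         (pm_M P i a `<=` Mset mt k.-1)%fset] /\
     [/\
         mu.-integrable [set: borel T] (EFin \o pm_p P i a) &
         (\int[mu]_x (pm_p P i a x)%:E = 1)%E]) ->
  (* the inner products <f^{i,a}, f(Z|.)>, <lam, f(Z|.)> are finite, Z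
     a subset of Z_k *)
  (forall (S : {set 'I_(mt k)}) i a, (i < pm_n P)%N -> (a < pm_h P i)%N ->
     mu.-integrable [set: borel T]
       (fun x => (pm_p P i a x * f (Zsub z S) x)%:E)) ->
  (forall S : {set 'I_(mt k)},
     mu.-integrable [set: borel T]
       (fun x => (pm_lam P x * f (Zsub z S) x)%:E)) ->
  (* conclusion: f(Z_k | X) f_{k|k-1}(X) is proportional (up to a
     mu-null set of single-target states) to the updated PMBM density *)
  exists C : R, exists N : set (borel T),
    [/\ measurable N, mu N = 0%E &
     forall X : {fset T}, (forall x, x \in X -> ~ N x) ->
       meas_lik nu f lamC z X * pmbm_dens mu P (Mset mt k.-1) X =
       C * pmbm_dens mu (pmbm_update mu f lamC k z E P) (Mset mt k) X].
Proof.
move=> k_gt0 _ E_neq0 E_inj f_ge0 _ lamC_ge0 _ lam_ge0 _ bernP int_p int_lam.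
have w_ge0 i a : (i < pm_n P)%N -> (a < pm_h P i)%N -> 0 <= pm_w P i a.
  by move=> ni ah; have [[]] := bernP i a ni ah.
have r_01 i a : (i < pm_n P)%N -> (a < pm_h P i)%N -> 0 <= pm_r P i a <= 1.
  by move=> ni ah; have [[]] := bernP i a ni ah.
have p_ge0 i a : (i < pm_n P)%N -> (a < pm_h P i)%N -> forall x, 0 <= pm_p P i a x.
  by move=> ni ah; have [[]] := bernP i a ni ah.
have M_sub i a : (i < pm_n P)%N -> (a < pm_h P i)%N ->
    (pm_M P i a `<=` Mset mt k.-1)%fset.
  by move=> ni ah; have [[]] := bernP i a ni ah.
(* Local hypotheses and subsets of [Z_k] are finite in number, so their exceptional null sets fit in
   one null set [N]. *)
have [N [mN N0 subN]] : {ae mu, forall x, regular_state mu f z P x}.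
  have ae_mu : Filter (almost_everywhere mu) := ae_filter_ringOfSetsType mu.
  have ae_p : {ae mu, forall x, forall (i : 'I_(pm_n P)) (a : 'I_(pm_h P i))
      (S : {set 'I_(mt k)}), inner mu (pm_p P i a) (f (Zsub z S)) = 0 ->
      pm_p P i a x * f (Zsub z S) x = 0}.
    apply: filter_forall => i; apply: filter_forall => a.
    apply: filter_forall => S.
    by apply: ae_inner_eq0 => //; [exact: p_ge0|exact: int_p].
  have ae_lam : {ae mu, forall x, forall S : {set 'I_(mt k)},
      inner mu (pm_lam P) (f (Zsub z S)) = 0 -> pm_lam P x * f (Zsub z S) x = 0}.
    by apply: filter_forall => S; exact: ae_inner_eq0.
  apply: filterS2 ae_p ae_lam => x Hp Hl; split => // S i a ni ah.
  exact: (Hp (Ordinal ni) (Ordinal ah)).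
set P' := pmbm_update mu f lamC k z E P.
pose W := \sum_(a : ghyp P | is_ghyp (Mset mt k.-1) a) hyp_weight a.
pose W' := \sum_(a : ghyp P' | is_ghyp (Mset mt k) a) hyp_weight a.
(* Ratio of the exponentials and of the total weights. If [W = 0], both sides are zero by
   [x / 0 = 0]. *)
exists (expR (- Rintegral nu [set: borel 'rV[R]_nz] lamC) *
  expR (- Rintegral mu [set: borel T] (pm_lam P)) /
  expR (- Rintegral mu [set: borel T] (pm_lam P')) * (W' / W)), N.
split => // X XN.
have X_regular x : x \in X -> regular_state mu f z P x.
  by move=> xX; apply: contrapT => nreg; apply: (XN x xX); exact: subN.
rewrite meas_likE !pmbm_densE -/W -/W'.
set L := \sum_(D : {ffun _ -> option _}) _.
set U' := \sum_(a : ghyp P' | _) _; set U := \sum_(b | _) _.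
have upd : U' = L * U.
  exact: (sum_updated_hyp k_gt0 E_neq0 E_inj f_ge0 lamC_ge0 lam_ge0 r_01
    p_ge0 M_sub X_regular).
(* If [W' = 0], all the nonnegative updated weights vanish, hence so does [U']. *)
have U'W' : W' * (U' / W') = U'.
  have [W0|W0] := eqVneq W' 0; last by field.
  rewrite W0 mul0r /U' big1 // => a aH.
  have /eqP := W0; rewrite psumr_eq0 => [/allP/(_ a)|b _]; last first.
    exact: updated_hyp_weight_ge0.
  by rewrite mem_index_enum aH => /(_ isT) /eqP ->; rewrite mul0r.
have eL'0 : expR (- Rintegral mu [set: borel T] (pm_lam P')) != 0.
  exact: lt0r_neq0 (expR_gt0 _).
transitivity (expR (- Rintegral nu [set: borel 'rV[R]_nz] lamC) *
    expR (- Rintegral mu [set: borel T] (pm_lam P)) * (L * U) / W); first by ring.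
(* The quotients of the constant are inserted by hand, [U'] as [W' * (U' / W')] and 1 as the updated
   exponential times its inverse; a ring identity remains. *)
by rewrite -upd -{1}U'W' -[LHS]mul1r -(mulfV eL'0); ring.
Qed.
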